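(* Let $\mathcal{H}$ be a finite-dimensional Hilbert space with quadratures $R_1,\ldots,R_N$ (self-adjoint operators on $\mathcal{H}$), let $D$ be the associated quantum Wasserstein distance, and let $g$ be the Wigner–Yanase metric. For any $\rho\in\mathcal{S}(\mathcal{H})$, $$D(\rho,\rho)^2=\frac14\sum_{i=1}^N g_\rho\left(\mathrm{i}[R_i,\rho],\,\mathrm{i}[R_i,\rho]\right).$$
   Context: $\mathcal{H}$ is a finite-dimensional complex Hilbert space, $\mathcal{H}^*$ its dual, $\mathcal{S}(\mathcal{K})$ the set of quantum states (positive semidefinite operators of trace one) on a Hilbert space $\mathcal{K}$. For a linear operator $X$ on $\mathcal{H}$, its transpose $X^T$ is the linear operator on $\mathcal{H}^*$ given by $X^T\langle\phi|=\langle\phi|X$. The space $\mathcal{H}\otimes\mathcal{H}^*$ is identified isometrically with the space of linear operators on $\mathcal{H}$ with Hilbert–Schmidt inner product $\langle\langle X|Y\rangle\rangle=\mathrm{Tr}[X^\dagger Y]$ via $|\psi\rangle\otimes\langle\phi|\mapsto|\psi\rangle\langle\phi|$; $|X\rangle\rangle$ denotes the vector corresponding to the operator $X$. $[X,Y]=XY-YX$. Couplings: $\mathcal{C}(\rho,\sigma)=\{\Pi\in\mathcal{S}(\mathcal{H}\otimes\mathcal{H}^* ):\ \mathrm{Tr}_{\mathcal{H}}\Pi=\rho^T,\ \mathrm{Tr}_{\mathcal{H}^*}\Pi=\sigma\}$. Cost: $C(\Pi)=\sum_{i=1}^N\mathrm{Tr}\left[(R_i\otimes\mathbb{I}_{\mathcal{H}^*}-\mathbb{I}_{\mathcal{H}}\otimes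 R_i^T)\,\Pi\,(R_i\otimes\mathbb{I}_{\mathcal{H}^*}-\mathbb{I}_{\mathcal{H}}\otimes R_i^T)\right]$. Distance: $D(\rho,\sigma)\ge0$ with $D(\rho,\sigma)^2=\inf_{\Pi\in\mathcal{C}(\rho,\sigma)}C(\Pi)$. Wigner–Yanase metric: the Riemannian metric $g$ on the manifold of quantum states of $\mathcal{H}$ given, for any $\rho\in\mathcal{S}(\mathcal{H})$ and any tangent vectors $X,Y$ at the point $\rho$ (regarded as operators on $\mathcal{H}$), by $g_\rho(X,Y)=4\,\langle\langle X|\left(\sqrt\rho\otimes\mathbb{I}_{\mathcal{H}^*}+\mathbb{I}_{\mathcal{H}}\otimes\sqrt\rho^{\,T}\right)^{-2}|Y\rangle\rangle$. *)

(* Defs.v *)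
From HB Require Import structures.
From mathcomp Require Import all_boot all_order all_algebra.
From mathcomp Require Import sesquilinear spectral.
From mathcomp Require Import complex mxtens.
From mathcomp Require Import classical_sets reals.

Set Implicit Arguments.
Unset Strict Implicit.
Unset Printing Implicit Defensive.

Import Order.TTheory GRing.Theory Num.Theory.
Local Open Scope ring_scope.
Local Open Scope sesquilinear_scope.

(* The Hilbert space H of dimension n is written in an orthonormal basis: vectors
   are elements of 'cV[R[i]]_n, operators of 'M[R[i]]_n, and the dual H^* carries
   the dual basis.  The operator X^T on H^* defined by X^T <phi| = <phi|X then
   has the matrix X^T (plain transpose, no conjugation).  Operators on
   H (x) H^* are matrices of size n * n, the tensor product of operators being
   the Kronecker product *t, so the basis vector |i> (x) <j| has the index
   mxtens_index (i, j). *)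

Section Operators.
Variables (R : realType).
Local Notation C := R[i].

Definition commutator n (X Y : 'M[C]_n) : 'M[C]_n := X *m Y - Y *m X.

Definition psdmx n (A : 'M[C]_n) : Prop :=
  A \is hermsymmx /\ forall v : 'cV[C]_n, 0 <= (v ^t* *m A *m v) 0 0.

Definition state n (A : 'M[C]_n) : Prop := psdmx A /\ \tr A = 1.

(* Functional calculus f(A) = U^-1 f(diag) U of a normal matrix A, where
   A = U^-1 diag U with U unitary. *)
Definition mxfun (f : C -> C) n (A : 'M[C]_n) : 'M[C]_n :=
  invmx (spectralmx A) *m diag_mx (map_mx f (spectral_diag A)) *m spectralmx A.

Definition mxsqrt n (A : 'M[C]_n) : 'M[C]_n := mxfun sqrtC A.

(* A^(-2), taken on the support of A when the self-adjoint A is singular: since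
   0^-1 = 0, this is the square of the Moore-Penrose inverse of A, and it is
   the inverse of A ^+ 2 when A is invertible. *)
Definition mxinv2 n (A : 'M[C]_n) : 'M[C]_n := mxfun (fun x => x ^- 2) A.

(* The vector |X>> of H (x) H^*, image of X under the isometry
   |psi><phi| |-> |psi> (x) <phi|. *)
Definition vecop n (X : 'M[C]_n) : 'cV[C]_(n * n) :=
  \col_k X (mxtens_unindex k).1 (mxtens_unindex k).2.

(* Partial traces over the first factor H and over the second factor H^*. *)
Definition ptrace1 n (P : 'M[C]_(n * n)) : 'M[C]_n :=
  \matrix_(j, l) \sum_i P (mxtens_index (i, j)) (mxtens_index (i, l)).

Definition ptrace2 n (P : 'M[C]_(n * n)) : 'M[C]_n :=
  \matrix_(i, k) \sum_j P (mxtens_index (i, j)) (mxtens_index (k, j)).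

Definition couplings n (rho sigma : 'M[C]_n) : set 'M[C]_(n * n) :=
  [set P | [/\ state P, ptrace1 P = rho^T & ptrace2 P = sigma]]%classic.

Definition transport_cost n N (Q : 'I_N -> 'M[C]_n) (P : 'M[C]_(n * n)) : C :=
  \sum_(k < N) \tr ((Q k *t 1%:M - 1%:M *t (Q k)^T) *m P *m
                    (Q k *t 1%:M - 1%:M *t (Q k)^T)).

(* For self-adjoint Q k the cost of a coupling is a nonnegative element of C;
   Re only casts it to R, where the infimum is taken. *)
Definition qwasserstein n N (Q : 'I_N -> 'M[C]_n) (rho sigma : 'M[C]_n) : R :=
  Num.sqrt
    (inf [set complex.Re (transport_cost Q P) | P in couplings rho sigma]%classic).

(* On a rank-deficient rho, the operator sqrt rho (x) 1 + 1 (x) sqrt rho^T is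
   singular exactly on the |X>> with X supported on ker rho on both sides, and
   every tangent vector at rho is orthogonal to these: its inverse square is
   taken on its support. *)
Definition wigner_yanase n (rho X Y : 'M[C]_n) : C :=
  4 * ((vecop X) ^t* *m
       mxinv2 (mxsqrt rho *t 1%:M + 1%:M *t (mxsqrt rho)^T) *m
       vecop Y) 0 0.

End Operators.

(* Main.v *)
(* Put S = sqrt rho.  The coupling |S>><<S| has cost sum_i Tr |[R_i, S]|^2, and
   in an eigenbasis of rho this is the right-hand side, since
   (p_j - p_i)^2 / (s_i + s_j)^2 = (s_j - s_i)^2 when p = s^2.

   Optimality amounts to Tr[(Y (x) Y^T) Pi] <= Tr[S Y S Y] for every coupling Pi
   of rho with itself and every self-adjoint Y.  Let g be the sesquilinear form
   g(A, B) = Tr[(A^* (x) B^T) Pi] on operators.  Positivity of Pi, tested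
   against A (x) 1 - 1 (x) B^T, bounds 2 Re g(A, B) by
   Tr[A^* A rho] + Tr[B B^* rho], and because both marginals of Pi come from the
   same rho, the bound is symmetric and passes to the hermitian part of g.  A
   hermitian form bounded in this way by two commuting positive forms, here
   the left and right multiplications by rho, is bounded by their geometric
   mean, which is A |-> Tr[A^* S A S]. *)
Require Import Defs.
From mathcomp Require Import all_boot all_order all_algebra.
From mathcomp Require Import sesquilinear spectral complex reals.
From mathcomp Require Import mxtens classical_sets ring.
Set Implicit Arguments.
Unset Strict Implicit.
Unset Printing Implicit Defensive.
Import Order.TTheory GRing.Theory Num.Theory.
Local Open Scope ring_scope.
Local Open Scope sesquilinear_scope.

(** * Hermitian forms, geometric means and functional calculus *)

Section HermitianForms.
Variable C : numClosedFieldType.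

Lemma adjmxM m n p (A : 'M[C]_(m, n)) (B : 'M[C]_(n, p)) :
  (A *m B)^t* = B^t* *m A^t*.
Proof. by rewrite trmx_mul map_mxM. Qed.

Lemma adjmxD m n (A B : 'M[C]_(m, n)) : (A + B)^t* = A^t* + B^t*.
Proof. by apply/matrixP => i j; rewrite !mxE rmorphD. Qed.

Lemma adjmxB m n (A B : 'M[C]_(m, n)) : (A - B)^t* = A^t* - B^t*.
Proof. by apply/matrixP => i j; rewrite !mxE rmorphB. Qed.

Lemma hermsymmx_adj n (A : 'M[C]_n) : (A \is hermsymmx) = (A^t* == A).
Proof. by rewrite is_hermitianmxE expr0 scale1r eq_sym. Qed.

Lemma unitarymx_adjK n (U : 'M[C]_n) : U \is unitarymx -> U^t* *m U = 1%:M.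
Proof. by move=> /unitarymxP /mulmx1C. Qed.

Lemma form_diagE n (d : 'rV[C]_n) (v : 'cV[C]_n) :
  (v^t* *m diag_mx d *m v) 0 0 = \sum_i d 0 i * `|v i 0| ^+ 2.
Proof.
rewrite mxE; apply: eq_bigr => i _; rewrite mul_mx_diag !mxE normCK.
by ring.
Qed.

Lemma form_adjE n (H : 'M[C]_n) (v w : 'cV[C]_n) :
  (w^t* *m H^t* *m v) 0 0 = ((v^t* *m H *m w) 0 0)^*.
Proof. by rewrite -[v in LHS]trmxCK -!adjmxM mulmxA !mxE. Qed.

(** In an orthonormal eigenbasis the form is a sum of squared moduli weighted by eigenvalues, and
    the change of basis preserves the norm, so it suffices to bound the eigenvalues. *)
Lemma hermitian_form_le n (M : 'M[C]_n) (d : C) : M^t* = M ->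
  (forall (l : C) (v : 'cV[C]_n), v != 0 -> M *m v = l *: v ->
     l \is Num.real -> l <= d) ->
  forall v : 'cV[C]_n, (v^t* *m M *m v) 0 0 <= d * \sum_i `|v i 0| ^+ 2.
Proof.
move=> hM eig v.
have Mh : M \is hermsymmx by rewrite hermsymmx_adj hM.
have /orthomx_spectralP ME := hermitian_normalmx Mh.
have Dre := hermitian_spectral_diag_real Mh.
have Uu := spectral_unitarymx M.
move: ME; rewrite invmx_unitary //.
set U := spectralmx M in Uu *; set D := spectral_diag M in Dre *.
move=> ME.
(* [U^* e_i] is an eigenvector for [D 0 i]; it is nonzero because [U] sends it to [e_i]. *)
have led i : D 0 i <= d.
  apply: (eig _ (U^t* *m delta_mx i 0)).
  - apply/eqP => /(congr1 (mulmx U)); rewrite mulmxA (unitarymxP Uu) mul1mx.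
    by rewrite mulmx0 => /matrixP /(_ i 0) /eqP; rewrite !mxE !eqxx oner_eq0.
  - rewrite ME -!mulmxA [U *m (_ *m _)]mulmxA (unitarymxP Uu) mul1mx.
    rewrite scalemxAr; congr (_ *m _); apply/matrixP => a b.
    by rewrite mul_diag_mx !mxE; case: (a =P i) => [->|]; rewrite ?mulr0.
  - exact: (mxOverP Dre).
have -> : v^t* *m M *m v = (U *m v)^t* *m diag_mx D *m (U *m v).
  by rewrite ME adjmxM !mulmxA.
have -> : \sum_i `|v i 0| ^+ 2 = \sum_i `|(U *m v) i 0| ^+ 2.
  have E (w : 'cV[C]_n) : \sum_i `|w i 0| ^+ 2 = (w^t* *m w) 0 0.
    by rewrite mxE; apply: eq_bigr => i _; rewrite !mxE normCK mulrC.
  rewrite !E adjmxM -mulmxA [U^t* *m (_ *m _)]mulmxA.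
  by rewrite unitarymx_adjK // mul1mx.
rewrite form_diagE mulr_sumr; apply: ler_sum => i _.
by rewrite ler_wpM2r // exprn_ge0.
Qed.

(** Rescaling the coordinates by [w = sqrt (x y)] turns the claim into the bound [l <= c] on the
    eigenvalues of [M]. At a pair [a], [b] built from an eigenvector, the hypothesis reads
    [2 l S <= 2 c S] with [S > 0]. *)
Lemma geometric_mean_pos n (H : 'M[C]_n) (x y : 'I_n -> C) (c : C) :
  H^t* = H -> 0 < c -> (forall i, 0 < x i) -> (forall i, 0 < y i) ->
  (forall a b : 'cV[C]_n,
     (a^t* *m H *m b) 0 0 + (b^t* *m H *m a) 0 0 <=
     c * (\sum_i x i ^+ 2 * `|a i 0| ^+ 2 + \sum_i y i ^+ 2 * `|b i 0| ^+ 2)) ->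
  forall v : 'cV[C]_n,
    (v^t* *m H *m v) 0 0 <= c * \sum_i x i * y i * `|v i 0| ^+ 2.
Proof.
move=> hH c0 x0 y0 bound v.
pose w i := sqrtC (x i * y i).
have w0 i : 0 < w i by rewrite sqrtC_gt0 mulr_gt0.
have wN i : w i != 0 by rewrite gt_eqF.
have wC i : (w i)^* = w i by apply/CrealP/gtr0_real.
have wE i : w i * w i = x i * y i by rewrite -expr2 sqrtCK.
pose M : 'M[C]_n := \matrix_(i, j) (H i j / (w i * w j)).
have HE i j : H i j = w i * M i j * w j.
  by rewrite mxE; field; rewrite !wN.
have hM : M^t* = M.
  apply/matrixP => i j; rewrite !mxE fmorph_div rmorphM /= !wC.
  by rewrite -[in RHS]hH !mxE; congr (_ / _); rewrite mulrC.
pose v' : 'cV[C]_n := \col_i (w i * v i 0).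
have -> : (v^t* *m H *m v) 0 0 = (v'^t* *m M *m v') 0 0.
  rewrite !mxE; apply: eq_bigr => j _; rewrite !mxE !mulr_suml.
  apply: eq_bigr => i _; rewrite HE !mxE rmorphM /= wC; ring.
have -> : \sum_i x i * y i * `|v i 0| ^+ 2 = \sum_i `|v' i 0| ^+ 2.
  apply: eq_bigr => i _.
  by rewrite !mxE normrM (gtr0_norm (w0 i)) exprMn [w i ^+ 2]expr2 wE.
apply: hermitian_form_le => // l u un0 Mu lr.
(* Test the bound on [b = u / w] and [a = (y / x) b], for which
   [H b = l w u] and [x^2 |a|^2 = y^2 |b|^2]. *)
pose b : 'cV[C]_n := \col_i (u i 0 / w i).
pose a : 'cV[C]_n := \col_i (y i / x i * b i 0).
pose S := \sum_i y i / x i * `|u i 0| ^+ 2.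
have S0 : 0 < S.
  have /cV0Pn[i ui] := un0.
  rewrite /S (bigD1 i) //= ltr_pwDl //.
    by rewrite mulr_gt0 ?divr_gt0 ?exprn_gt0 ?normr_gt0.
  by apply: sumr_ge0 => j _; rewrite mulr_ge0 ?divr_ge0 ?exprn_ge0 // ltW.
have Hb : H *m b = \col_i (l * w i * u i 0).
  apply/colP => i; rewrite [RHS]mxE mxE.
  have /colP/(_ i) := Mu; rewrite [RHS]mxE mxE => E.
  rewrite -mulrA mulrCA -E mulr_sumr; apply: eq_bigr => j _.
  by rewrite HE !mxE; field; rewrite !wN.
have xN i : x i != 0 by rewrite gt_eqF.
have aHb : (a^t* *m H *m b) 0 0 = l * S.
  rewrite -mulmxA Hb mxE /S mulr_sumr; apply: eq_bigr => i _.
  rewrite !mxE !rmorphM !fmorphV /= wC normCK.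
  have -> : (x i)^* = x i by apply/CrealP/gtr0_real.
  have -> : (y i)^* = y i by apply/CrealP/gtr0_real.
  by field; rewrite !wN xN.
have bHa : (b^t* *m H *m a) 0 0 = l * S.
  rewrite -{1}hH form_adjE aHb; apply/CrealP; rewrite realM //.
  exact: gtr0_real.
have := bound a b; rewrite aHb bHa.
have bE i : y i ^+ 2 * `|b i 0| ^+ 2 = y i / x i * `|u i 0| ^+ 2.
  rewrite mxE normrM normfV (gtr0_norm (w0 i)) exprMn exprVn [w i ^+ 2]expr2 wE.
  by field; rewrite xN gt_eqF.
have aE i : x i ^+ 2 * `|a i 0| ^+ 2 = y i / x i * `|u i 0| ^+ 2.
  rewrite -bE mxE normrM gtr0_norm ?divr_gt0 // exprMn.
  by field; rewrite xN.
rewrite (eq_bigr _ (fun i _ => aE i)) (eq_bigr _ (fun i _ => bE i)) -/S.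
by rewrite mulrDr -!mulr2n lerMn2r /= ler_pM2r.
Qed.

Lemma geometric_mean_le n (H : 'M[C]_n) (x y : 'I_n -> C) (c : C) :
  H^t* = H -> 0 < c -> (forall i, 0 <= x i) -> (forall i, 0 <= y i) ->
  (forall a b : 'cV[C]_n,
     (a^t* *m H *m b) 0 0 + (b^t* *m H *m a) 0 0 <=
     c * (\sum_i x i ^+ 2 * `|a i 0| ^+ 2 + \sum_i y i ^+ 2 * `|b i 0| ^+ 2)) ->
  forall v : 'cV[C]_n,
    (v^t* *m H *m v) 0 0 <= c * \sum_i x i * y i * `|v i 0| ^+ 2.
Proof.
move=> hH c0 x0 y0 bound v.
set T := \sum_i _.
(* For [e <= 1], [(x + e) (y + e) <= x y + e (x + y + 1)], so [e * (c * B)] bounds the error of the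
   perturbation. *)
pose B := \sum_i (x i + y i + 1) * `|v i 0| ^+ 2.
have B0 : 0 <= B.
  by apply: sumr_ge0 => i _; rewrite mulr_ge0 ?exprn_ge0 ?addr_ge0.
(* Perturb [x] and [y] to [x + e] and [y + e] and let [e] tend to [0]. *)
have step e : 0 < e -> e <= 1 -> (v^t* *m H *m v) 0 0 <= c * T + e * (c * B).
  move=> e0 e1.
  have := @geometric_mean_pos _ H (fun i => x i + e) (fun i => y i + e) c hH c0.
  move=> /(_ _ _ _ v) h.
  apply: le_trans (h _ _ _) _ => [i|i|a b|].
  - exact: ltr_wpDl.
  - exact: ltr_wpDl.
  - apply: le_trans (bound a b) _; rewrite ler_pM2l // lerD //;
      apply: ler_sum => i _; apply: ler_wpM2r; rewrite ?exprn_ge0 //;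
      by rewrite lerXn2r ?nnegrE ?lerDl ?addr_ge0 // ltW.
  rewrite mulrCA -mulrDr ler_pM2l // /T /B mulr_sumr -big_split /=.
  apply: ler_sum => i _; rewrite [e * _]mulrA -mulrDl ler_wpM2r ?exprn_ge0 //.
  have -> : (x i + e) * (y i + e) = x i * y i + e * (x i + y i + e) by ring.
  by rewrite lerD2l ler_pM2l // lerD2l.
apply/ler_addgt0Pr => e e0.
have K0 : 0 < c * B + 1 + e.
  by rewrite ltr_pwDr // addr_ge0 // mulr_ge0 // ltW.
(* This value is at most 1, and its product with [c * B] is at most [e]. *)
have := step (e / (c * B + 1 + e)).
rewrite divr_gt0 // ler_pdivrMr // mul1r lerDr.
have cB : 0 <= c * B by rewrite mulr_ge0 // ltW.
move=> /(_ isT); rewrite addr_ge0 // => /(_ isT) /le_trans; apply.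
rewrite lerD2l mulrAC -mulrA ger_pMr // ler_pdivrMr // mul1r.
by rewrite -addrA lerDl addr_ge0 // ltW.
Qed.

(** Frees the functional calculus from the particular diagonalization chosen by [spectralmx]. *)
Lemma spectral_calculus_unique n (f : C -> C) (V W : 'M[C]_n) (d e : 'rV[C]_n) :
  V \is unitarymx -> W \is unitarymx ->
  V^t* *m diag_mx d *m V = W^t* *m diag_mx e *m W ->
  V^t* *m diag_mx (map_mx f d) *m V = W^t* *m diag_mx (map_mx f e) *m W.
Proof.
move=> Vu Wu E.
(* [T] intertwines [diag d] and [diag e], that is, [T i j <> 0] forces
   [d j = e i], and then it intertwines [f d] and [f e]. *)
pose T := W *m V^t*.
have TE d' e' : V^t* *m diag_mx d' *m V = W^t* *m diag_mx e' *m W <->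
    T *m diag_mx d' = diag_mx e' *m T.
  split=> [F|F].
    rewrite /T -[W *m _ *m _](mulmxtVK _ Vu) -!mulmxA [V^t* *m (_ *m _)]mulmxA.
    rewrite [(V^t* *m diag_mx d' *m _)]mulmxA F !mulmxA (unitarymxP Wu).
    by rewrite mul1mx.
  rewrite -[LHS]mul1mx -(unitarymx_adjK Wu) -!mulmxA; congr (_ *m _).
  rewrite [V^t* *m (_ *m _)]mulmxA [W *m _]mulmxA [W *m _]mulmxA -/T F /T.
  by rewrite -!mulmxA unitarymx_adjK // mulmx1.
apply/TE; move/TE: E => /matrixP E.
apply/matrixP => i j; have := E i j.
rewrite !mul_mx_diag !mul_diag_mx !mxE.
have [->|Tij] := eqVneq (\sum_k W i k * V^t* k j) 0.
  by rewrite !mul0r !mulr0.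
by rewrite mulrC => /(mulIf Tij) ->; rewrite mulrC.
Qed.

End HermitianForms.

(** * Operators as vectors, and partial traces *)

Section Vectorization.
Variable R : realType.
Local Notation C := R[i].

Lemma sum_mxtens_index (V : nmodType) m n (F : 'I_(m * n) -> V) :
  \sum_k F k = \sum_i \sum_j F (mxtens_index (i, j)).
Proof.
rewrite pair_big /= (reindex (@mxtens_index m n)) /=.
  by apply: eq_bigr => -[].
exists (@mxtens_unindex m n) => i _; first exact: mxtens_indexK.
exact: mxtens_unindexK.
Qed.

Lemma adjmx_tens m n p q (A : 'M[C]_(m, n)) (B : 'M[C]_(p, q)) :
  (A *t B)^t* = A^t* *t B^t*.
Proof. by apply/matrixP => i j; rewrite !mxE rmorphM. Qed.

Lemma tensmx11 m n : (1%:M : 'M[C]_m) *t (1%:M : 'M[C]_n) = 1%:M.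
Proof.
apply/matrixP => k l.
case: (mxtens_indexP k) => i j; case: (mxtens_indexP l) => i' j'.
rewrite tensmxE !mxE -natrM mulnb; congr (_%:R).
by rewrite (inj_eq (can_inj (@mxtens_indexK m n))) xpair_eqE.
Qed.

Lemma mulmx_tens_vecop n (A B X : 'M[C]_n) :
  (A *t B) *m vecop X = vecop (A *m X *m B^T).
Proof.
apply/colP => k; case: (mxtens_indexP k) => i j.
rewrite !mxE sum_mxtens_index !mxtens_indexK /= exchange_big /=.
apply: eq_bigr => l _; rewrite !mxE mulr_suml; apply: eq_bigr => l' _.
by rewrite tensmxE mxE mxtens_indexK /=; ring.
Qed.

Lemma vecop_dot n (X Y : 'M[C]_n) :
  ((vecop X)^t* *m vecop Y) 0 0 = \tr (X^t* *m Y).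
Proof.
rewrite mxE sum_mxtens_index exchange_big; apply: eq_bigr => j _ /=.
rewrite mxE; apply: eq_bigr => i _.
by rewrite !mxE mxtens_indexK.
Qed.

Lemma vecop_surj n (v : 'cV[C]_(n * n)) : exists X, v = vecop X.
Proof.
exists (\matrix_(i, j) v (mxtens_index (i, j)) 0); apply/colP => k.
by case: (mxtens_indexP k) => i j; rewrite !mxE mxtens_indexK.
Qed.

Lemma mxtrace_tens_ptrace2 n (A : 'M[C]_n) (P : 'M[C]_(n * n)) :
  \tr ((A *t 1%:M) *m P) = \tr (A *m ptrace2 P).
Proof.
rewrite /mxtrace sum_mxtens_index; apply: eq_bigr => i _.
rewrite [RHS]mxE; under eq_bigr do rewrite mxE sum_mxtens_index.
rewrite exchange_big; apply: eq_bigr => k _ /=; rewrite mxE mulr_sumr.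
apply: eq_bigr => j _; rewrite (bigD1 j) //= big1 => [|l /negPf lj].
  by rewrite tensmxE mxE eqxx mulr1 addr0.
by rewrite tensmxE [_ j l]mxE eq_sym lj mulr0 mul0r.
Qed.

Lemma mxtrace_tens_ptrace1 n (B : 'M[C]_n) (P : 'M[C]_(n * n)) :
  \tr ((1%:M *t B) *m P) = \tr (B *m ptrace1 P).
Proof.
rewrite /mxtrace sum_mxtens_index exchange_big; apply: eq_bigr => j _ /=.
rewrite [RHS]mxE; under eq_bigr do rewrite mxE sum_mxtens_index exchange_big.
rewrite exchange_big; apply: eq_bigr => l _ /=; rewrite mxE mulr_sumr.
apply: eq_bigr => i _; rewrite (bigD1 i) //= big1 => [|k /negPf ki].
  by rewrite tensmxE mxE eqxx mul1r addr0.
by rewrite tensmxE [_ i k]mxE eq_sym ki !mul0r.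
Qed.

Lemma mxtrace_adj n (A : 'M[C]_n) : \tr (A^t*) = (\tr A)^*.
Proof. by rewrite trace_map_mx mxtrace_tr. Qed.

(** Each diagonal entry of the product is the form of [P] at the adjoint of a row of [M]. *)
Lemma psdmx_tr_ge0 m n (P : 'M[C]_n) (M : 'M[C]_(m, n)) :
  psdmx P -> 0 <= \tr (M *m P *m M^t*).
Proof.
case=> _ Pge0; apply: sumr_ge0 => i _.
have := Pge0 ((row i M)^t*); rewrite trmxCK; congr (_ <= _).
rewrite -row_mul mxE [RHS]mxE; apply: eq_bigr => j _.
by rewrite !mxE.
Qed.

(** The realignment (reshuffling) of [P]: it groups the two indices on H against the two on the
    dual. It is the matrix of the sesquilinear form [g] on operators. *)
Definition realign n (P : 'M[C]_(n * n)) : 'M[C]_(n * n) :=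
  \matrix_(p, q) P (mxtens_index ((mxtens_unindex p).1, (mxtens_unindex q).1))
                   (mxtens_index ((mxtens_unindex p).2, (mxtens_unindex q).2)).

Lemma form_realign n (P : 'M[C]_(n * n)) (A B : 'M[C]_n) :
  ((vecop A)^t* *m realign P *m vecop B) 0 0 = \tr ((A^t* *t B^T) *m P).
Proof.
rewrite mxE sum_mxtens_index exchange_big.
rewrite /mxtrace [RHS]sum_mxtens_index [RHS]exchange_big.
apply: eq_bigr => j _ /=.
under eq_bigr do rewrite mxE mulr_suml sum_mxtens_index.
under [RHS]eq_bigr do rewrite mxE sum_mxtens_index.
rewrite exchange_big [RHS]exchange_big; apply: eq_bigr => k _ /=.
rewrite exchange_big; apply: eq_bigr => i _; apply: eq_bigr => l _.
by rewrite tensmxE !mxE !mxtens_indexK /=; ring.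
Qed.

End Vectorization.

(** * Bounds valid for every coupling *)

Section Couplings.
Variable R : realType.
Local Notation C := R[i].

Lemma tensmx_sub_mul (K : comPzRingType) n (A B A' B' : 'M[K]_n) :
  (A *t 1%:M - 1%:M *t B) *m (A' *t 1%:M - 1%:M *t B') =
  (A *m A') *t 1%:M - A *t B' - (A' *t B - 1%:M *t (B *m B')).
Proof. by rewrite mulmxBl !mulmxBr !tensmx_mul !mul1mx !mulmx1. Qed.

(** The marginals determine the two diagonal terms; only the cross terms depend on [P]. Four
    independent operators let it serve both the cost and the positivity test. *)
Lemma coupling_trE n (rho sigma A A' B B' : 'M[C]_n) (P : 'M[C]_(n * n)) :
  couplings rho sigma P ->
  \tr ((A *t 1%:M - 1%:M *t B^T) *m P *m (A' *t 1%:M - 1%:M *t B'^T)) =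
  \tr (A' *m A *m sigma) + \tr (B *m B' *m rho)
  - \tr ((A' *t B^T) *m P) - \tr ((A *t B'^T) *m P).
Proof.
case=> _ P1 P2; rewrite mxtrace_mulC mulmxA.
have trB4 (X Y Z W : 'M[C]_(n * n)) : \tr ((X - Y - (Z - W)) *m P) =
    \tr (X *m P) + \tr (W *m P) - \tr (Y *m P) - \tr (Z *m P).
  by rewrite !mulmxBl !raddfB /=; ring.
rewrite tensmx_sub_mul trB4.
congr (_ + _ - _ - _).
  by rewrite mxtrace_tens_ptrace2 P2.
rewrite mxtrace_tens_ptrace1 P1 -mxtrace_tr !trmx_mul !trmxK.
by rewrite mxtrace_mulC.
Qed.

Lemma coupling_tr_ge0 n (rho sigma A A' B B' : 'M[C]_n) (P : 'M[C]_(n * n)) :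
  A^t* = A' -> B^t* = B' -> couplings rho sigma P ->
  0 <= \tr (A' *m A *m sigma) + \tr (B *m B' *m rho)
  - \tr ((A' *t B^T) *m P) - \tr ((A *t B'^T) *m P).
Proof.
move=> AA BB cP; rewrite -(coupling_trE A A' B B' cP).
have -> : A' *t 1%:M - 1%:M *t B'^T = (A *t 1%:M - 1%:M *t B^T)^t*.
  by rewrite adjmxB !adjmx_tens !trmx1 !map_mx1 AA -BB map_trmx.
by case: cP => -[] /psdmx_tr_ge0.
Qed.

Lemma tens_tr_conj n (A B : 'M[C]_n) (P : 'M[C]_(n * n)) : P^t* = P ->
  (\tr ((A^t* *t B^T) *m P))^* = \tr ((A *t (B^t*)^T) *m P).
Proof.
move=> hP; rewrite -mxtrace_adj adjmxM hP adjmx_tens mxtrace_mulC trmxCK.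
by rewrite !map_trmx.
Qed.

Lemma mxtrace_diag_r n (X : 'M[C]_n) (d : 'rV[C]_n) :
  \tr (X^t* *m X *m diag_mx d) = \sum_i \sum_j d 0 j * `|X i j| ^+ 2.
Proof.
rewrite exchange_big; apply: eq_bigr => j _.
rewrite mul_mx_diag mxE mxE mulr_suml; apply: eq_bigr => i _.
by rewrite !mxE normCK; ring.
Qed.

Lemma mxtrace_diag_l n (X : 'M[C]_n) (d : 'rV[C]_n) :
  \tr (X *m X^t* *m diag_mx d) = \sum_i \sum_j d 0 i * `|X i j| ^+ 2.
Proof.
apply: eq_bigr => i _.
rewrite mul_mx_diag mxE mxE mulr_suml; apply: eq_bigr => j _.
by rewrite !mxE normCK; ring.
Qed.

Lemma mxtrace_diag_lr n (Z : 'M[C]_n) (d : 'rV[C]_n) : Z^t* = Z ->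
  \tr (diag_mx d *m Z *m diag_mx d *m Z) =
  \sum_i \sum_j d 0 i * d 0 j * `|Z i j| ^+ 2.
Proof.
move=> hZ; apply: eq_bigr => i _; rewrite mxE; apply: eq_bigr => j _.
have zc : (Z i j)^* = Z j i by rewrite -[in RHS]hZ !mxE.
by rewrite mul_mx_diag mul_diag_mx !mxE normCK zc; ring.
Qed.

(** The entrywise conjugate of [U] is its action on the dual basis; the product sends |X>> to |U X
    U^*>>, a change of basis for operators. *)
Lemma tens_conj_unitary n (U : 'M[C]_n) : U \is unitarymx ->
  U *t (map_mx Num.conj U) \is unitarymx.
Proof.
move=> Uu; apply/unitarymxP; rewrite adjmx_tens tensmx_mul (unitarymxP Uu).
have /unitarymxP -> : map_mx Num.conj U \is unitarymx by rewrite conjC_unitary.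
exact: tensmx11.
Qed.

Lemma mulmx_conj_vecop n (U X : 'M[C]_n) :
  (U *t (map_mx Num.conj U)) *m vecop X = vecop (U *m X *m U^t*).
Proof. by rewrite mulmx_tens_vecop map_trmx. Qed.

Definition uconj n (U W : 'M[C]_n) : 'M[C]_n := U^t* *m W *m U.

Lemma uconjM n (U W W' : 'M[C]_n) : U \is unitarymx ->
  uconj U W *m uconj U W' = uconj U (W *m W').
Proof. by move=> Uu; rewrite /uconj !mulmxA mulmxtVK. Qed.

Lemma uconj_adj n (U W : 'M[C]_n) : (uconj U W)^t* = uconj U (W^t*).
Proof. by rewrite /uconj !adjmxM trmxCK mulmxA. Qed.

Lemma mxtrace_uconj n (U W : 'M[C]_n) : U \is unitarymx ->
  \tr (uconj U W) = \tr W.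
Proof.
by move=> Uu; rewrite /uconj mxtrace_mulC mulmxA (unitarymxP Uu) mul1mx.
Qed.

Lemma uconjK n (U W : 'M[C]_n) : U \is unitarymx ->
  uconj U (U *m W *m U^t*) = W.
Proof.
move=> Uu; rewrite /uconj !mulmxA unitarymx_adjK // mul1mx -mulmxA.
by rewrite unitarymx_adjK // mulmx1.
Qed.

(** In an eigenbasis of [rho], left and right multiplication by [rho] are both diagonal on matrix
    units, so [geometric_mean_le] applies entrywise; it is then evaluated at [Y]. *)
Lemma coupling_overlap_le n (rho U : 'M[C]_n) (s : 'rV[C]_n)
    (P : 'M[C]_(n * n)) (Y : 'M[C]_n) :
  U \is unitarymx -> (forall i, 0 <= s 0 i) ->
  rho = uconj U (diag_mx (map_mx (fun x => x ^+ 2) s)) ->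
  couplings rho rho P -> Y^t* = Y ->
  \tr ((Y *t Y^T) *m P) <=
  \tr (uconj U (diag_mx s) *m Y *m uconj U (diag_mx s) *m Y).
Proof.
move=> Uu s0 rhoE cP hY.
have [[Ppsd _] _ _] := cP.
have hP : P^t* = P.
  by apply/eqP; rewrite -hermsymmx_adj; case: Ppsd.
pose V := U *t (map_mx Num.conj U).
have Vu : V \is unitarymx by exact: tens_conj_unitary.
(* Twice the hermitian part of [g]; hence the constant 2 given to [geometric_mean_le]. *)
pose G := realign P + (realign P)^t*.
have hG : G^t* = G by rewrite /G adjmxD trmxCK addrC.
have GE A B : ((vecop A)^t* *m G *m vecop B) 0 0 =
    \tr ((A^t* *t B^T) *m P) + \tr ((B *t (A^t*)^T) *m P).
  rewrite mulmxDr mulmxDl mxE; congr (_ + _); first exact: form_realign.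
  by rewrite form_adjE form_realign; apply: tens_tr_conj.
(* [K] is [G] written in the eigenbasis of [rho]. *)
have [K hK KE] : exists2 K : 'M[C]_(n * n), K^t* = K & forall X Z,
    ((vecop X)^t* *m K *m vecop Z) 0 0 =
    \tr (((uconj U X)^t* *t (uconj U Z)^T) *m P) +
    \tr ((uconj U Z *t ((uconj U X)^t*)^T) *m P).
  exists (V *m G *m V^t*); first by rewrite !adjmxM trmxCK hG mulmxA.
  have VE W : vecop (uconj U W) = V^t* *m vecop W.
    rewrite /V adjmx_tens mulmx_tens_vecop; congr (vecop (_ *m _)).
    by apply/matrixP => i j; rewrite !mxE conjCK.
  by move=> X Z; rewrite -GE !VE adjmxM trmxCK !mulmxA.
(* On the matrix unit of index [k], right multiplication by [rho] has eigenvalue [x k ^+ 2] (column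
   index) and left multiplication [y k ^+ 2] (row index). *)
pose x (k : 'I_(n * n)) := s 0 (mxtens_unindex k).2.
pose y (k : 'I_(n * n)) := s 0 (mxtens_unindex k).1.
have := @geometric_mean_le _ _ K x y 2 hK.
rewrite ltr0n => /(_ isT (fun=> s0 _) (fun=> s0 _)) bound.
have {bound} := bound _ (vecop (U *m Y *m U^t*)).
rewrite KE (uconjK _ Uu) hY.
move: (\tr ((Y *t Y^T) *m P)) => t.
rewrite -mulr2n -(mulr_natl t) ler_pM2l; last exact: ltr0n.
move=> bound.
apply: le_trans (bound _) _ => [a b|]; last first.
  rewrite le_eqVlt; apply/orP; left; apply/eqP.
  rewrite sum_mxtens_index.
  set Z := U *m Y *m U^t*.
  have hZ : Z^t* = Z by rewrite /Z !adjmxM trmxCK hY mulmxA.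
  rewrite -{1 2}(uconjK Y Uu) !uconjM // mxtrace_uconj //.
  rewrite (mxtrace_diag_lr _ hZ); apply: eq_bigr => i _; apply: eq_bigr => j _.
  by rewrite /x /y mxE !mxtens_indexK /= [s 0 j * _]mulrC.
have [X ->] := vecop_surj a; have [Z ->] := vecop_surj b.
rewrite !KE.
set A := uconj U X; set B := uconj U Z.
have trA : \sum_i x i ^+ 2 * `|vecop X i 0| ^+ 2 = \tr (A^t* *m A *m rho).
  rewrite rhoE /A uconj_adj !uconjM // mxtrace_uconj // mxtrace_diag_r.
  rewrite sum_mxtens_index; apply: eq_bigr => i _; apply: eq_bigr => j _.
  by rewrite /x !mxE mxtens_indexK.
have trB : \sum_i y i ^+ 2 * `|vecop Z i 0| ^+ 2 = \tr (B *m B^t* *m rho).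
  rewrite rhoE /B uconj_adj !uconjM // mxtrace_uconj // mxtrace_diag_l.
  rewrite sum_mxtens_index; apply: eq_bigr => i _; apply: eq_bigr => j _.
  by rewrite /y !mxE mxtens_indexK.
rewrite trA trB.
(* Positivity is tested at the pair [A], [B] and at the pair of adjoints of [B], [A]. Both marginals
   come from [rho], so the two diagonal terms merely trade places, and the sum contains all four
   cross terms of [K]. *)
have h1 := coupling_tr_ge0 (erefl (A^t*)) (erefl (B^t*)) cP.
have h2 := coupling_tr_ge0 (trmxCK B) (trmxCK A) cP.
have sum_le (a1 a2 a3 a4 u v : C) : 0 <= u + v - a1 - a4 ->
    0 <= v + u - a2 - a3 -> a1 + a2 + (a3 + a4) <= 2 * (u + v).
  move=> le1 le2; rewrite -subr_ge0; have := addr_ge0 le1 le2.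
  by congr (_ <= _); ring.
exact: sum_le h1 h2.
Qed.

End Couplings.

(** * The Wigner-Yanase metric in an eigenbasis of the state *)

Section WignerYanase.
Variable R : realType.
Local Notation C := R[i].

Lemma mxfun_uconj n (f : C -> C) (U : 'M[C]_n) (d : 'rV[C]_n) :
  U \is unitarymx ->
  mxfun f (uconj U (diag_mx d)) = uconj U (diag_mx (map_mx f d)).
Proof.
move=> Uu; set A := uconj U _.
have An : A \is normalmx.
  by apply/orthomx_spectral_subproof; exists (U, d); rewrite //= invmx_unitary.
have Su := spectral_unitarymx A.
have /orthomx_spectralP AE := An.
have invS := invmx_unitary Su; rewrite invS in AE.
rewrite /mxfun invS.
by apply: spectral_calculus_unique Su Uu _; exact: esym AE.
Qed.

(** Parametrizing by the square roots [s] of the eigenvalues makes [rho] and its square root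
    diagonal together, with polynomial entries in [s]. *)
Lemma state_spectral n (rho : 'M[C]_n) : state rho ->
  exists (U : 'M[C]_n) (s : 'rV[C]_n),
    [/\ U \is unitarymx, forall i, 0 <= s 0 i,
        rho = uconj U (diag_mx (map_mx (fun x => x ^+ 2) s)) &
        mxsqrt rho = uconj U (diag_mx s)].
Proof.
move=> [[rhoh rhop] _]; exists (spectralmx rho).
exists (map_mx (fun x => sqrtC x) (spectral_diag rho)).
have Uu := spectral_unitarymx rho.
have /orthomx_spectralP rhoE := hermitian_normalmx rhoh.
rewrite (invmx_unitary Uu) in rhoE.
(* The form of [rho] at its [i]-th unit eigenvector is the eigenvalue. *)
have d0 i : 0 <= spectral_diag rho 0 i.
  have := rhop ((spectralmx rho)^t* *m delta_mx i 0).
  rewrite {2}rhoE adjmxM trmxCK !mulmxA mulmxtVK // -!mulmxA.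
  rewrite [spectralmx rho *m _]mulmxA (unitarymxP Uu) mul1mx mulmxA form_diagE.
  rewrite (bigD1 i) //= big1 => [|j /negPf ji].
    by rewrite mxE !eqxx normr1 expr1n mulr1 addr0.
  by rewrite mxE ji normr0 expr0n mulr0.
have sqE : map_mx (fun x => x ^+ 2)
    (map_mx (fun x => sqrtC x) (spectral_diag rho)) = spectral_diag rho.
  by apply/rowP => i; rewrite !mxE sqrtCK.
split; first exact: Uu.
- by move=> i; rewrite mxE sqrtC_ge0.
- by rewrite sqE; exact: rhoE.
- by rewrite /mxsqrt /mxfun (invmx_unitary Uu).
Qed.

Lemma uconj_tens n (U A B : 'M[C]_n) :
  uconj (U *t (map_mx Num.conj U)) (A *t B) = uconj U A *t (uconj U B^T)^T.
Proof.
rewrite /uconj adjmx_tens !tensmx_mul !trmx_mul trmxK mulmxA; congr (_ *t _).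
by congr (_ *m _ *m _); apply/matrixP => i j; rewrite !mxE ?conjCK.
Qed.

Lemma uconjD n (U A B : 'M[C]_n) : uconj U (A + B) = uconj U A + uconj U B.
Proof. by rewrite /uconj mulmxDr mulmxDl. Qed.

Lemma uconj1 n (U : 'M[C]_n) : U \is unitarymx -> uconj U 1%:M = 1%:M.
Proof. by move=> Uu; rewrite /uconj mulmx1 unitarymx_adjK. Qed.

(** With S = [uconj U (diag_mx s)], the operator sends |X>> to |SX + XS>>, which in the eigenbasis
    multiplies the entry [X i j] by [s_i + s_j]. *)
Lemma anticommutator_uconj n (U : 'M[C]_n) (s : 'rV[C]_n) : U \is unitarymx ->
  uconj U (diag_mx s) *t 1%:M + 1%:M *t (uconj U (diag_mx s))^T =
  uconj (U *t (map_mx Num.conj U))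
    (diag_mx (\row_k (s 0 (mxtens_unindex k).1 + s 0 (mxtens_unindex k).2))).
Proof.
move=> Uu.
have -> : diag_mx (\row_k (s 0 (mxtens_unindex k).1 + s 0 (mxtens_unindex k).2))
    = diag_mx s *t 1%:M + 1%:M *t diag_mx s.
  apply/matrixP => k l.
  case: (mxtens_indexP k) => i j; case: (mxtens_indexP l) => i' j'.
  rewrite [RHS]mxE !tensmxE !mxE (inj_eq (can_inj (@mxtens_indexK n n))).
  rewrite xpair_eqE !mxtens_indexK /=.
  by case: eqP => _; case: eqP => _ /=; ring.
by rewrite uconjD !uconj_tens trmx1 tr_diag_mx uconj1 // trmx1.
Qed.

Lemma commutator_uconj n (U A B : 'M[C]_n) : U \is unitarymx ->
  commutator (uconj U A) (uconj U B) = uconj U (commutator A B).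
Proof.
move=> Uu; rewrite /commutator !uconjM //.
by rewrite /uconj mulmxBr mulmxBl.
Qed.

Lemma commutator_diagE n (A : 'M[C]_n) (d : 'rV[C]_n) i j :
  commutator A (diag_mx d) i j = A i j * (d 0 j - d 0 i).
Proof. by rewrite /commutator mul_mx_diag mul_diag_mx !mxE; ring. Qed.

Lemma mxtrace_adjmul n (X : 'M[C]_n) :
  \tr (X^t* *m X) = \sum_i \sum_j `|X i j| ^+ 2.
Proof.
rewrite exchange_big; apply: eq_bigr => j _.
rewrite mxE; apply: eq_bigr => i _.
by rewrite !mxE normCK mulrC.
Qed.

Lemma vecop_uconj n (U X : 'M[C]_n) : U \is unitarymx ->
  (U *t (map_mx Num.conj U)) *m vecop (uconj U X) = vecop X.
Proof.
move=> Uu; rewrite mulmx_conj_vecop /uconj !mulmxA (unitarymxP Uu) mul1mx.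
by rewrite -mulmxA (unitarymxP Uu) mulmx1.
Qed.

Lemma vecop_form_uconj n (U X : 'M[C]_n) (d : 'rV[C]_(n * n)) :
  U \is unitarymx ->
  ((vecop (uconj U X))^t* *m
     uconj (U *t (map_mx Num.conj U)) (diag_mx d) *m
     vecop (uconj U X)) 0 0 =
  \sum_i \sum_j d 0 (mxtens_index (i, j)) * `|X i j| ^+ 2.
Proof.
move=> Uu; set V := U *t _.
have VX := vecop_uconj X Uu.
have -> : (vecop (uconj U X))^t* *m uconj V (diag_mx d) *m vecop (uconj U X) =
    (V *m vecop (uconj U X))^t* *m diag_mx d *m (V *m vecop (uconj U X)).
  by rewrite adjmxM /uconj !mulmxA.
rewrite VX form_diagE sum_mxtens_index.
apply: eq_bigr => i _; apply: eq_bigr => j _.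
by rewrite mxE mxtens_indexK.
Qed.

(** Once everything is expressed in the eigenbasis, both sides are sums over entries of [Z], the
    matrix of [Q] there, and are compared term by term. *)
Lemma wigner_yanase_commutator n (rho Q : 'M[C]_n) : state rho ->
  wigner_yanase rho ('i *: commutator Q rho) ('i *: commutator Q rho) =
  4 * \tr ((commutator Q (mxsqrt rho))^t* *m commutator Q (mxsqrt rho)).
Proof.
case/state_spectral => U [s [Uu s0 rhoE sqrtE]].
rewrite /wigner_yanase sqrtE anticommutator_uconj // rhoE.
rewrite -(uconjK Q Uu) !commutator_uconj //; set Z := U *m Q *m U^t*.
have iE (W : 'M[C]_n) : 'i *: uconj U W = uconj U ('i *: W).
  by rewrite /uconj -scalemxAr -scalemxAl.
have iEij (W : 'M[C]_n) i j : ('i *: W) i j = 'i * W i j by rewrite mxE.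
rewrite iE /mxinv2 mxfun_uconj; last exact: tens_conj_unitary.
rewrite vecop_form_uconj // uconj_adj uconjM // mxtrace_uconj // mxtrace_adjmul.
congr (_ * _); apply: eq_bigr => i _; apply: eq_bigr => j _.
rewrite iEij !commutator_diagE !mxE mxtens_indexK /=.
rewrite !normrM normCi mul1r !exprMn mulrCA; congr (_ * _).
(* On the kernel of the anticommutator [s_i = s_j = 0], and both differences vanish; elsewhere the
   factor [s_i + s_j] cancels. *)
have [z|nz] := eqVneq (s 0 i + s 0 j) 0.
  have := z; move/eqP; rewrite paddr_eq0 // => /andP[/eqP -> /eqP ->].
  by rewrite !subrr normr0 expr0n mulr0.
have -> : s 0 j ^+ 2 - s 0 i ^+ 2 = (s 0 i + s 0 j) * (s 0 j - s 0 i) by ring.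
rewrite normrM exprMn (ger0_norm (addr_ge0 (s0 i) (s0 j))).
by field.
Qed.

End WignerYanase.

(** * Optimality of the coupling |S>><<S| *)

Section Optimal.
Variable R : realType.
Local Notation C := R[i].

Lemma mxsqrtP n (rho : 'M[C]_n) : state rho ->
  (mxsqrt rho)^t* = mxsqrt rho /\ mxsqrt rho *m mxsqrt rho = rho.
Proof.
case/state_spectral => U [s [Uu s0 rhoE ->]]; split.
  rewrite uconj_adj; congr (uconj U _); apply/matrixP => i j.
  rewrite !mxE eq_sym; case: eqP => [->|_] /=; last by rewrite conjC0.
  rewrite !mulr1n; apply/CrealP/ger0_real; exact: s0.
rewrite uconjM // rhoE; congr (uconj U _); apply/matrixP => i j.
by rewrite mul_diag_mx !mxE; case: eqP => [->|_]; rewrite ?mulr0.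
Qed.

(** Expanded by cyclicity into the shape of [coupling_trE], so that in [cost_ge] the two sides
    differ only in the overlap term, which occurs twice. *)
Lemma commutator_normE n (Q S : 'M[C]_n) : Q^t* = Q -> S^t* = S ->
  \tr ((commutator Q S)^t* *m commutator Q S) =
  \tr (Q *m Q *m (S *m S)) + \tr (Q *m Q *m (S *m S))
  - \tr (S *m Q *m S *m Q) - \tr (S *m Q *m S *m Q).
Proof.
move=> hQ hS.
have trBB (X Y Z W : 'M[C]_n) : \tr ((X - Y) *m (Z - W)) =
    \tr (X *m Z) + \tr (Y *m W) - \tr (X *m W) - \tr (Y *m Z).
  by rewrite mulmxBl !mulmxBr !raddfB /=; ring.
rewrite /commutator adjmxB !adjmxM hQ hS trBB.
have congr4 (a b c d a' b' c' d' : C) : a = a' -> b = b' -> c = c' -> d = d' ->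
    a + b - c - d = a' + b' - c' - d' by move=> -> -> -> ->.
apply: congr4.
- by rewrite -(mulmxA S) mxtrace_mulC !mulmxA.
- by rewrite mulmxA mxtrace_mulC !mulmxA.
- by rewrite !mulmxA.
- by rewrite -(mulmxA Q) mxtrace_mulC !mulmxA.
Qed.

Lemma cost_ge n (rho Q : 'M[C]_n) (P : 'M[C]_(n * n)) :
  state rho -> Q^t* = Q -> couplings rho rho P ->
  \tr ((commutator Q (mxsqrt rho))^t* *m commutator Q (mxsqrt rho)) <=
  \tr ((Q *t 1%:M - 1%:M *t Q^T) *m P *m (Q *t 1%:M - 1%:M *t Q^T)).
Proof.
move=> st hQ cP; have [hS SS] := mxsqrtP st.
rewrite (commutator_normE hQ hS) (coupling_trE Q Q Q Q cP) SS.
have [U [s [Uu s0 rhoE sE]]] := state_spectral st.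
have le := coupling_overlap_le Uu s0 rhoE cP hQ; rewrite -sE in le.
exact: lerB (lerB (lexx _) le) le.
Qed.

(** |S>> is the canonical purification of [rho]: the marginals of |S>><<S| are [S S^*] and the
    transpose of [S^* S], and [S] is self-adjoint with square [rho]. *)
Lemma purification_coupling n (rho : 'M[C]_n) : state rho ->
  couplings rho rho (vecop (mxsqrt rho) *m (vecop (mxsqrt rho))^t*).
Proof.
move=> st; have [hS SS] := mxsqrtP st; have [_ tr1] := st.
set S := mxsqrt rho in hS SS *.
have SC i j : (S i j)^* = S j i by rewrite -[in RHS]hS !mxE.
have PE i j k l : (vecop S *m (vecop S)^t*) (mxtens_index (i, j))
    (mxtens_index (k, l)) = S i j * (S k l)^*.
  by rewrite mxE big_ord1 !mxE !mxtens_indexK.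
split.
- split.
    split; first by rewrite hermsymmx_adj adjmxM trmxCK.
    move=> v; set w := vecop S.
    have -> : v^t* *m (w *m w^t*) *m v = (w^t* *m v)^t* *m (w^t* *m v).
      by rewrite adjmxM trmxCK !mulmxA.
    by rewrite mxE big_ord1 !mxE mulrC mul_conjC_ge0.
  by rewrite mxtrace_mulC trace_mx11 vecop_dot hS SS.
- apply/matrixP => j l; rewrite [LHS]mxE [RHS]mxE -SS [RHS]mxE.
  by apply: eq_bigr => i _; rewrite PE SC mulrC.
- apply/matrixP => i k; rewrite [LHS]mxE -SS [RHS]mxE.
  by apply: eq_bigr => j _; rewrite PE SC.
Qed.

Lemma mxtrace_rank1 n (M : 'M[C]_n) (w : 'cV[C]_n) : M^t* = M ->
  \tr (M *m (w *m w^t*) *m M) = ((M *m w)^t* *m (M *m w)) 0 0.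
Proof.
move=> hM; rewrite -{2}hM -mulmxA -(mulmxA w) -adjmxM mulmxA.
by rewrite mxtrace_mulC trace_mx11.
Qed.

(** The cost operator sends |S>> to |QS - SQ>>, and the trace is the squared norm of that vector. *)
Lemma purification_cost n (Q S : 'M[C]_n) : Q^t* = Q ->
  \tr ((Q *t 1%:M - 1%:M *t Q^T) *m (vecop S *m (vecop S)^t*) *m
       (Q *t 1%:M - 1%:M *t Q^T)) =
  \tr ((commutator Q S)^t* *m commutator Q S).
Proof.
move=> hQ; set M := _ - _.
have hM : M^t* = M.
  have hQT : (Q^T)^t* = Q^T by rewrite -map_trmx hQ.
  by rewrite /M adjmxB !adjmx_tens !trmx1 !map_mx1 hQ hQT.
have MS : M *m vecop S = vecop (commutator Q S).
  rewrite /M mulmxBl !mulmx_tens_vecop trmx1 mul1mx mulmx1 trmxK.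
  by apply/colP => k; rewrite /commutator !mxE.
have := mxtrace_rank1 (vecop S) hM; rewrite MS vecop_dot; exact.
Qed.

End Optimal.

Theorem proposition6 (R : realType) (n N : nat) (Q : 'I_N -> 'M[R[i]]_n)
    (hQ : forall k : 'I_N, Q k \is hermsymmx)
    (rho : 'M[R[i]]_n) (hrho : state rho) :
  ((qwasserstein Q rho rho ^+ 2)%:C)%C =
  4^-1 * \sum_(k < N) wigner_yanase rho ('i *: commutator (Q k) rho)
                                        ('i *: commutator (Q k) rho).
Proof.
have hQa k : (Q k)^t* = Q k by apply/eqP; rewrite -hermsymmx_adj.
set S := mxsqrt rho.
pose c := \sum_(k < N) \tr ((commutator (Q k) S)^t* *m commutator (Q k) S).
have -> : 4^-1 * \sum_(k < N) wigner_yanase rho ('i *: commutator (Q k) rho)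
    ('i *: commutator (Q k) rho) = c.
  rewrite mulr_sumr; apply: eq_bigr => k _.
  by rewrite wigner_yanase_commutator // mulKf // pnatr_eq0.
have c0 : 0 <= c.
  apply: sumr_ge0 => k _; rewrite mxtrace_adjmul.
  by apply: sumr_ge0 => i _; apply: sumr_ge0 => j _; rewrite exprn_ge0.
have cE : (complex.Re c)%:C%C = c by apply/RRe_real/ger0_real.
pose E :=
  [set complex.Re (transport_cost Q P) | P in couplings rho rho]%classic.
have cin : E (complex.Re c).
  exists (vecop S *m (vecop S)^t*); first exact: purification_coupling.
  congr complex.Re; apply: eq_bigr => k _; exact: purification_cost.
have clb : lbound E (complex.Re c).
  move=> _ [P cP <-].
  have : c <= transport_cost Q P by apply: ler_sum => k _; apply: cost_ge.
  by rewrite lecE => /andP[].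
(* The infimum is attained: the same real number is a member of [E], giving nonemptiness, and a
   lower bound of it. *)
have infE : inf E = complex.Re c.
  apply/eqP; rewrite eq_le; apply/andP; split.
    by apply: ge_inf cin; exists (complex.Re c).
  by apply: lb_le_inf clb; exists (complex.Re c).
rewrite -[RHS]cE /qwasserstein -/E infE sqr_sqrtr //.
by rewrite -ler0c cE.
Qed.
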